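(* Let $k\ge 2$ be an integer and let $\rho$ be the map that sends each $\sigma\in S_k$ to the $(k-1)\times(k-1)$ real matrix $\rho(\sigma)$ defined in the context. Then $\rho$ is a faithful group representation of $S_k$ of dimension $k-1$; that is, $\rho(\sigma)$ is invertible for every $\sigma\in S_k$, $\rho(\sigma\tau)=\rho(\sigma)\rho(\tau)$ for all $\sigma,\tau\in S_k$, and $\rho:S_k\to \mathrm{GL}_{k-1}(\mathbb{R})$ is injective.
   Context: $S_k$ is the group of permutations of $\{1,\dots,k\}$, with products composed from right to left, $(\sigma\tau)(i)=\sigma(\tau(i))$. A permutation $\sigma\in S_k$ acts on a vector $v=(v_1,\dots,v_k)\in\mathbb{R}^k$ by moving the entry in position $i$ to position $\sigma(i)$, i.e. $(\sigma v)_{\sigma(i)}=v_i$. For example, for $k=4$, $\sigma=(1234)$ sends $(0,x,y,z)$ to $(z,0,x,y)$. Let $\psi:\mathbb{R}^k\to\mathbb{R}^{k-1}$ be given by $\psi(x_1,x_2,\dots,x_k)=(x_2-x_1,\dots,x_k-x_1)$. Definition of $\rho(\sigma)$: for $(x_1,\dots,x_{k-1})\in\mathbb{R}^{k-1}$, the vector $\psi\big(\sigma(0,x_1,\dots,x_{k-1})\big)\in\mathbb{R}^{k-1}$ depends linearly on $(x_1,\dots,x_{k-1})$, and $\rho(\sigma)=(a_{i,j})$ is the matrix of its coefficients: the $i$-th coordinate of $\psi\big(\sigma(0,x_1,\dots,x_{k-1})\big)$ equals $\sum_{j=1}^{k-1}a_{i,j}x_j$. For example, for $k=4$ and $\sigma=(1234)$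 one gets $(0,x,y,z)\mapsto(z,0,x,y)\mapsto(-z,x-z,y-z)$, so $\rho(\sigma)=\begin{pmatrix}0&0&-1\\1&0&-1\\0&1&-1\end{pmatrix}$. *)

(* Defs.v *)
From mathcomp Require Import all_boot all_order all_algebra all_fingroup.
From mathcomp Require Import reals.

Set Implicit Arguments.
Unset Strict Implicit.
Unset Printing Implicit Defensive.

Import GRing.Theory.
Local Open Scope ring_scope.

(* Throughout, k = n.+1, positions 1, ..., k are the elements of 'I_n.+1
   (position 1 is ord0), and vectors are columns. *)

(* Permutations composed from right to left. The group law of 'S_k composes
   from left to right, hence the swap. *)
Definition perm_comp (k : nat) (s t : 'S_k) : 'S_k := (t * s)%g.

Lemma perm_compE (k : nat) (s t : 'S_k) (i : 'I_k) :
  perm_comp s t i = s (t i).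
Proof. by rewrite permM. Qed.

(* row_perm s^-1 reads position s^-1 i of v, so that the entry of v in position
   i moves to position s i: see perm_actE. *)
Definition perm_act (R : realType) (k : nat) (s : 'S_k) (v : 'cV[R]_k) :
  'cV[R]_k := row_perm s^-1 v.

Lemma perm_actE (R : realType) (k : nat) (s : 'S_k) (v : 'cV[R]_k) (i : 'I_k) :
  perm_act s v (s i) 0 = v i 0.
Proof. by rewrite mxE permK. Qed.

Definition cons0 (R : realType) (n : nat) (x : 'cV[R]_n) : 'cV[R]_n.+1 :=
  col_mx (0 : 'cV[R]_1) x.

Definition psi (R : realType) (n : nat) (x : 'cV[R]_n.+1) : 'cV[R]_n :=
  \col_(i < n) (x (lift ord0 i) 0 - x ord0 0).

Definition psi_act (R : realType) (n : nat) (s : 'S_n.+1) (x : 'cV[R]_n) :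
  'cV[R]_n := psi (perm_act s (cons0 x)).

(* The coefficient matrix of the linear map psi_act s: its j-th column is the
   image of the j-th basis vector. That these are the coefficients of psi_act s
   is psi_actE. *)
Definition rho (R : realType) (n : nat) (s : 'S_n.+1) : 'M[R]_n :=
  \matrix_(i < n, j < n) psi_act s (delta_mx j 0) i 0.

Lemma cons0_sum (R : realType) (n : nat) (x : 'cV[R]_n) (p : 'I_n.+1) :
  cons0 x p 0 = \sum_j cons0 (delta_mx j 0 : 'cV[R]_n) p 0 * x j 0.
Proof.
rewrite /cons0 mxE; case: splitP => i p_i.
  rewrite mxE big1 // => j _; rewrite mxE; case: splitP => i' p_i'.
    by rewrite mxE mul0r.
  by move: (ltn_ord i); rewrite -p_i p_i'.
rewrite (bigD1 i) //= mxE; case: splitP => i' p_i'.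
  by move: (ltn_ord i'); rewrite -p_i' p_i.
have -> : i' = i by apply: val_inj; apply: (@addnI 1); rewrite -p_i -p_i'.
rewrite mxE !eqxx mul1r big1 ?addr0 // => j ji; rewrite mxE.
case: splitP => l p_l; first by rewrite mxE mul0r.
have -> : l = i by apply: val_inj; apply: (@addnI 1); rewrite -p_i -p_l.
by rewrite mxE eq_sym (negPf ji) mul0r.
Qed.

Lemma psi_actE (R : realType) (n : nat) (s : 'S_n.+1) (x : 'cV[R]_n) (i : 'I_n) :
  psi_act s x i 0 = \sum_j rho R s i j * x j 0.
Proof.
have psi_act_coef y : psi_act s y i 0 =
    cons0 y (s^-1 (lift ord0 i))%g 0 - cons0 y (s^-1 ord0)%g 0.
  by rewrite mxE; congr (_ - _); rewrite [LHS]mxE.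
rewrite psi_act_coef (cons0_sum x (_ (lift _ _))) (cons0_sum x (_ ord0)) -sumrB.
by apply: eq_bigr => j _; rewrite [rho _ _ _ _]mxE psi_act_coef mulrBl.
Qed.

(* Main.v *)
(* Adding a constant vector to v does not change psi (s v), and v - psi v
   (with psi v extended by 0) is constant, so psi (s (psi v)) = psi (s v): this
   gives multiplicativity. For injectivity, apply s and t to the vector
   (0, 1, ..., k - 1): if rho s = rho t, then the two images differ by a
   constant, which is 0 because they have the same sum of entries. *)
Require Import Defs.
From mathcomp Require Import all_boot all_order all_algebra all_fingroup.
From mathcomp Require Import reals.

Set Implicit Arguments.
Unset Strict Implicit.
Unset Printing Implicit Defensive.

Import GRing.Theory.
Local Open Scope ring_scope.

Lemma perm_act_comp (R : realType) (k : nat) (s t : 'S_k) (v : 'cV[R]_k) :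
  perm_act (perm_comp s t) v = perm_act s (perm_act t v).
Proof. by rewrite /perm_act /perm_comp invMg row_permM. Qed.

Lemma cons0_ord0 (R : realType) (n : nat) (x : 'cV[R]_n) : cons0 x ord0 0 = 0.
Proof. by rewrite -[ord0](lshift0 n 0) [LHS]col_mxEu mxE. Qed.

Lemma cons0_lift (R : realType) (n : nat) (x : 'cV[R]_n) (i : 'I_n) :
  cons0 x (lift ord0 i) 0 = x i 0.
Proof. by rewrite -rshift1 [LHS]col_mxEd. Qed.

Lemma cons0_psi (R : realType) (n : nat) (v : 'cV[R]_n.+1) (p : 'I_n.+1) :
  cons0 (psi v) p 0 = v p 0 - v ord0 0.
Proof.
case: (unliftP ord0 p) => [i ->|->]; first by rewrite cons0_lift mxE.
by rewrite cons0_ord0 subrr.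
Qed.

Lemma psi_act_psi (R : realType) (n : nat) (s : 'S_n.+1) (v : 'cV[R]_n.+1) :
  psi_act s (psi v) = psi (perm_act s v).
Proof.
apply/colP => i; rewrite [LHS]mxE [RHS]mxE 4![row_perm _ _ _ _]mxE.
(* Both entries of [cons0 (psi v)] carry the same shift [- v ord0 0], which cancels in their
   difference. *)
by rewrite !cons0_psi opprB addrA addrNK.
Qed.

Lemma rho_mul (R : realType) (n : nat) (s : 'S_n.+1) (x : 'cV[R]_n) :
  rho R s *m x = psi_act s x.
Proof. by apply/colP => i; rewrite psi_actE mxE. Qed.

(** Applied to a basis vector, a matrix returns the corresponding column. *)
Lemma cV_mulmx_inj (R : pzSemiRingType) (m n : nat) (A B : 'M[R]_(m, n)) :
  (forall x : 'cV[R]_n, A *m x = B *m x) -> A = B.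
Proof.
move=> eqAB; apply/matrixP => i j.
by have /colP/(_ i) := eqAB (delta_mx j 0); rewrite -!colE !mxE.
Qed.

Lemma rho_comp (R : realType) (n : nat) (s t : 'S_n.+1) :
  rho R (perm_comp s t) = rho R s *m rho R t.
Proof.
apply: cV_mulmx_inj => x.
(* [psi_act_psi] allows a [psi] to be inserted between the actions of [t] and [s]. *)
by rewrite -mulmxA !rho_mul {1}/psi_act perm_act_comp -psi_act_psi.
Qed.

Lemma psi_cons0 (R : realType) (n : nat) (x : 'cV[R]_n) : psi (cons0 x) = x.
Proof. by apply/colP => i; rewrite mxE cons0_lift cons0_ord0 subr0. Qed.

Lemma rho1 (R : realType) (n : nat) : rho R (1%g : 'S_n.+1) = 1%:M.
Proof.
apply: cV_mulmx_inj => x.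
by rewrite rho_mul mul1mx /psi_act /perm_act invg1 row_perm1 psi_cons0.
Qed.

Lemma rho_unit (R : realType) (n : nat) (s : 'S_n.+1) : rho R s \in unitmx.
Proof.
have : rho R s *m rho R s^-1%g = 1%:M.
  (* [perm_comp] swaps its factors, so the product to simplify is [s^-1 * s]. *)
  by rewrite -rho_comp /perm_comp mulVg rho1.
by case/mulmx1_unit.
Qed.

Lemma sum_perm_act (R : realType) (k : nat) (s : 'S_k) (v : 'cV[R]_k) :
  \sum_p perm_act s v p 0 = \sum_p v p 0.
Proof.
by rewrite (reindex_perm s); apply: eq_bigr => p _; rewrite perm_actE.
Qed.

Lemma psi_sum_inj (R : realType) (n : nat) (u v : 'cV[R]_n.+1) :
  psi u = psi v -> \sum_p u p 0 = \sum_p v p 0 -> u = v.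
Proof.
move=> eq_psi eq_sum.
have uvE p : u p 0 - v p 0 = u ord0 0 - v ord0 0.
  have := cons0_psi u p; rewrite eq_psi cons0_psi => eq_p.
  by apply/eqP; rewrite subr_eq -addrA addrC -subr_eq -eq_p addrC.
have /eqP := eq_sum; rewrite -subr_eq0 -sumrB (eq_bigr _ (fun p _ => uvE p)).
(* The constant difference, summed over all [n.+1] positions, is 0; since [n.+1] is nonzero in [R],
   the constant vanishes. *)
rewrite sumr_const card_ord -mulr_natr mulf_eq0 Num.Theory.pnatr_eq0 orbF.
move=> /eqP c0; apply/colP => p.
by apply/eqP; rewrite -subr_eq0 uvE c0.
Qed.

Lemma rho_inj (R : realType) (n : nat) : injective (@rho R n).
Proof.
move=> s t eq_rho; pose v : 'cV[R]_n.+1 := \col_p (p : nat)%:R.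
have eq_act : perm_act s v = perm_act t v.
  apply: psi_sum_inj; last by rewrite !sum_perm_act.
  by rewrite -!psi_act_psi -!rho_mul eq_rho.
(* Entry [p] of [perm_act s v] is the index [s^-1 p] cast into [R], so the images of [v] determine
   the inverse permutations; the cast is injective in characteristic 0. *)
apply: invg_inj; apply/permP => p; apply: val_inj.
have /colP/(_ p)/eqP := eq_act.
by rewrite !mxE Num.Theory.eqr_nat => /eqP.
Qed.

Theorem theorem2 (R : realType) (n : nat) (hk : (2 <= n.+1)%N) :
  [/\ forall s : 'S_n.+1, rho R s \in unitmx,
      forall s t : 'S_n.+1, rho R (perm_comp s t) = rho R s *m rho R t
    & injective (fun s : 'S_n.+1 => rho R s)].
Proof.
split; [exact: rho_unit | exact: rho_comp | exact: rho_inj].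
Qed.
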